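(* Let $n$ be a positive integer. Let $\Omega_0$ be the matrix of the standard symplectic form on $\mathbb{R}^{2n}$. Let $M\in\mathcal{M}_{2n}(\mathbb{R})$ be a symmetric and invertible matrix such that $\Omega_0^{-1}M$ is diagonalizable over $\mathbb{C}$. Then there exists a symplectic matrix $S\in\mathcal{M}_{2n}(\mathbb{R})$ such that $S^TMS$ is a block-diagonal matrix with blocks of hyperbolic, elliptic or focus-focus type with $k=1$.
   Context: $\Omega_0\in\mathcal{M}_{2n}(\mathbb{R})$ is block-diagonal with $n$ blocks $\begin{pmatrix}0&1\\ -1&0\end{pmatrix}$; $S$ is symplectic if $S^T\Omega_0S=\Omega_0$. The diagonal blocks with $k=1$ are: - hyperbolic type: $\begin{pmatrix}0&r\\ r&a\end{pmatrix}$ with $r\in\mathbb{R}$, $a\in\{-1,0,1\}$ and $a=0$ if $r\neq0$; - elliptic type: $\begin{pmatrix}r&0\\ 0&r\end{pmatrix}$ with $r\in\mathbb{R}$; - focus-focus type: $\begin{pmatrix}0&s&0&r\\ s&0&-r&0\\ 0&-r&0&s\\ r&0&s&0\end{pmatrix}$ with $r,s\in\mathbb{R}$. *)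

(* Defs.v *)
From mathcomp Require Import all_boot all_order all_algebra.
From mathcomp Require Import reals.
From mathcomp.real_closed Require Import complex.

Set Implicit Arguments.
Unset Strict Implicit.
Unset Printing Implicit Defensive.

Import GRing.Theory.
Local Open Scope ring_scope.

Definition mx_of_rows (R : realType) (m : nat) (rows : seq (seq R)) : 'M[R]_m :=
  \matrix_(i < m, j < m) nth 0 (nth [::] rows i) j.

(* The sizes [p i] of the diagonal blocks may vary with [i], so the size of
   [\mxdiag_i B i] is a sum, transported here to the ambient size [m]. *)
Definition block_diag (R : realType) (k : nat) (p : 'I_k -> nat)
    (B : forall i : 'I_k, 'M[R]_(p i)) (m : nat)
    (e : (\sum_(i < k) p i)%N = m) : 'M[R]_m :=
  castmx (e, e) (\mxdiag_(i < k) B i).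

Lemma sum_size2 (n : nat) : (\sum_(i < n) 2)%N = (2 * n)%N.
Proof. by rewrite sum_nat_const card_ord mulnC. Qed.

Definition Omega0_block (R : realType) : 'M[R]_2 :=
  mx_of_rows 2 [:: [:: 0; 1]; [:: -1; 0]].

Definition Omega0 (R : realType) (n : nat) : 'M[R]_(2 * n) :=
  block_diag (fun _ : 'I_n => Omega0_block R) (sum_size2 n).

Definition symplectic (R : realType) (n : nat) (S : 'M[R]_(2 * n)) : Prop :=
  S^T *m Omega0 R n *m S = Omega0 R n.

Definition hyperbolic_block (R : realType) (r a : R) : 'M[R]_2 :=
  mx_of_rows 2 [:: [:: 0; r];
                   [:: r; a]].

Definition elliptic_block (R : realType) (r : R) : 'M[R]_2 :=
  mx_of_rows 2 [:: [:: r; 0];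
                   [:: 0; r]].

Definition focus_focus_block (R : realType) (r s : R) : 'M[R]_4 :=
  mx_of_rows 4 [:: [:: 0;  s;   0; r];
                   [:: s;  0; - r; 0];
                   [:: 0; - r;  0; s];
                   [:: r;  0;   s; 0]].

Inductive williamson_block (R : realType) : forall m : nat, 'M[R]_m -> Prop :=
| Hyperbolic (r a : R) of a \in [:: -1; 0; 1] & (r != 0 -> a = 0) :
    williamson_block (hyperbolic_block r a)
| Elliptic (r : R) : williamson_block (elliptic_block r)
| FocusFocus (r s : R) : williamson_block (focus_focus_block r s).

Definition diagonalizable_over_C (R : realType) (m : nat) (A : 'M[R]_m) : Prop :=
  diagonalizable (map_mx (real_complex R) A).

(* Main.v *)
(* Symplectic Gram-Schmidt: vectors are rows, and eigenvectors are taken for the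
   pencil x M = lambda x Omega.  Given a spanning family of complex eigenvectors,
   nondegeneracy of Omega provides two of them, w and z, with Omega(w, z) <> 0;
   symmetry of M and antisymmetry of Omega force their eigenvalues to be opposite.
   The real and imaginary parts of w and z yield a hyperbolic plane (real
   eigenvalue), an elliptic plane (imaginary eigenvalue) or a focus-focus 4-space
   (otherwise).  Its Omega-orthogonal complement is also M-orthogonal to it, and the
   eigenvectors, projected there, still span, so one concludes by induction on the
   dimension. *)
Require Import Defs.
From mathcomp Require Import all_boot all_order all_algebra.
From mathcomp Require Import reals.
From mathcomp.real_closed Require Import complex.
From mathcomp Require Import ring lra zify.

Set Implicit Arguments.
Unset Strict Implicit.
Unset Printing Implicit Defensive.

Import Order.TTheory GRing.Theory Num.Theory.
Local Open Scope ring_scope.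

(** * Bilinear forms on row vectors and their Gram matrices *)

Section BilinearForm.
Variables (F : comNzRingType) (m : nat).
Implicit Types (G : 'M[F]_m) (x y z : 'rV[F]_m).

Definition pairing G x y : F := (x *m G *m y^T) 0 0.

Lemma pairingDl G x y z : pairing G (x + y) z = pairing G x z + pairing G y z.
Proof. by rewrite /pairing !mulmxDl mxE. Qed.

Lemma pairingDr G x y z : pairing G x (y + z) = pairing G x y + pairing G x z.
Proof. by rewrite /pairing linearD mulmxDr mxE. Qed.

Lemma pairingZl G a x y : pairing G (a *: x) y = a * pairing G x y.
Proof. by rewrite /pairing -!scalemxAl mxE. Qed.

Lemma pairingZr G a x y : pairing G x (a *: y) = a * pairing G x y.
Proof. by rewrite /pairing linearZ -scalemxAr mxE. Qed.

Lemma pairingNl G x y : pairing G (- x) y = - pairing G x y.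
Proof. by rewrite -scaleN1r pairingZl mulN1r. Qed.

Lemma pairingNr G x y : pairing G x (- y) = - pairing G x y.
Proof. by rewrite -scaleN1r pairingZr mulN1r. Qed.

Definition pairingE := (pairingDl, pairingDr, pairingZl, pairingZr, pairingNl, pairingNr).

Lemma pairing_tr G x y : pairing G^T x y = pairing G y x.
Proof. by rewrite /pairing -[in RHS]trace_mx11 -mxtrace_tr trace_mx11 !trmx_mul trmxK mulmxA. Qed.

Lemma pairing_sym G x y : G^T = G -> pairing G x y = pairing G y x.
Proof. by move=> sG; rewrite -pairing_tr sG. Qed.

Lemma pairing_skew G x y : G^T = - G -> pairing G x y = - pairing G y x.
Proof. by move=> sG; rewrite -pairing_tr sG /pairing mulmxN mulNmx mxE. Qed.

Lemma gramE p q G (A : 'M_(p, m)) (B : 'M_(q, m)) i j :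
  (A *m G *m B^T) i j = pairing G (row i A) (row j B).
Proof.
by rewrite /pairing tr_row -row_mul !mxE; apply: eq_bigr => k _; rewrite !mxE.
Qed.

Definition frame (s : seq 'rV[F]_m) : 'M[F]_(size s, m) :=
  \matrix_(i < size s) nth 0 s i.

End BilinearForm.

(** Serves the last clause of [splits_off]. Past the end of [s], [nth] returns the zero row, so [i]
    can be any natural number. *)
Lemma nth_frame_sub (F : fieldType) m (s : seq 'rV[F]_m) (G : 'M[F]_m) i :
  (nth 0 s i *m G <= frame s *m G)%MS.
Proof.
have [si|/(nth_default 0) ->] := ltnP i (size s); last by rewrite mul0mx sub0mx.
by rewrite submxMr // (_ : nth 0 s i = row (Ordinal si) (frame s)) ?row_sub // rowK.
Qed.

(** Rank-nullity; with [A] equal to [Omega *m X^T], the rows of [Y] form a basis of the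
    Omega-orthogonal complement of the rows of [X]. *)
Lemma row_free_kernel (F : fieldType) m p q (A : 'M[F]_(m, p)) :
  row_full A -> m = (p + q)%N ->
  exists2 Y : 'M_(q, m), row_free Y & Y *m A = 0.
Proof.
move=> fA mpq; have rk : \rank (kermx A) = q.
  by rewrite mxrank_ker (eqP fA) mpq addKn.
rewrite -rk; exists (row_base (kermx A)); first exact: row_base_free.
by apply/eqP; rewrite -sub_kermx eq_row_base.
Qed.

Lemma mul_block_gram (F : comNzRingType) m p q (X : 'M[F]_(p, m)) (Y : 'M_(q, m))
    (G : 'M_m) :
  col_mx X Y *m G *m (col_mx X Y)^T =
  block_mx (X *m G *m X^T) (X *m G *m Y^T) (Y *m G *m X^T) (Y *m G *m Y^T).
Proof. by rewrite tr_col_mx mul_col_mx mul_col_row. Qed.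

Lemma tr_gram (F : comNzRingType) m p q (X : 'M[F]_(p, m)) (Y : 'M_(q, m)) (G : 'M_m) :
  (X *m G *m Y^T)^T = Y *m G^T *m X^T.
Proof. by rewrite !trmx_mul trmxK mulmxA. Qed.

(** * The standard symplectic matrix *)

Section Williamson.
Variable R : realType.

(** An entrywise form of [Omega0], free of casts and defined for every size. *)
Definition stdJ m : 'M[R]_m :=
  \matrix_(i < m, j < m)
    if ~~ odd i && (j == i.+1 :> nat) then 1
    else if odd i && (i == j.+1 :> nat) then -1 else 0.

(** As [p] is even, shifting indices by [p] keeps their parity and no pair of coordinates straddles
    the cut. *)
Lemma stdJ_block p q : ~~ odd p -> stdJ (p + q) = block_mx (stdJ p) 0 0 (stdJ q).
Proof.
move=> evp; apply/matrixP => i j.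
by case: (split_ordP i) => i' ->; case: (split_ordP j) => j' ->;
  rewrite ?(block_mxEul, block_mxEur, block_mxEdl, block_mxEdr) !mxE /=
    ?oddD ?(negPf evp) //= -?addnS ?eqn_add2l //;
  have := ltn_ord i'; have := ltn_ord j';
  do ?case: ifP => //; lia.
Qed.

Lemma stdJ_skew m : (stdJ m)^T = - stdJ m.
Proof.
apply/matrixP => i j; rewrite !mxE.
by do ?case: ifP => //; rewrite ?opprK ?oppr0 //; lia.
Qed.

Lemma stdJ_unit m : ~~ odd m -> stdJ m \in unitmx.
Proof.
move=> /even_halfK <-; elim: m./2 => [|k IH]; first by rewrite unitmxE det_mx00 unitr1.
rewrite doubleS -add2n unitmxE stdJ_block // det_ublock unitrM -!unitmxE IH andbT.
suff /mulmx1_unit[] : stdJ 2 *m - stdJ 2 = 1%:M by [].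
apply/matrixP=> -[[|[|//]] ?] [[|[|//]] ?];
  by rewrite !mxE !big_ord_recl big_ord0 !mxE /=; ring.
Qed.

Lemma Omega0E n : Omega0 R n = stdJ (2 * n).
Proof.
(* The size and the cast are generalised so that the induction can peel off one block and eliminate
   the cast. *)
suff H k m (e : (\sum_(i < k) 2)%N = m) :
  castmx (e, e) (\mxdiag_(i < k) Omega0_block R) = stdJ m by exact: H.
elim: k m e => [|k IH] m e.
  apply/matrixP => i; exfalso.
  by have := leq_ltn_trans (leq0n i) (ltn_ord i); rewrite -e big_ord0.
rewrite mxdiag_recl castmx_comp.
move: (etrans _ _) => e'; case: _ / e'; rewrite castmx_id stdJ_block //.
have := IH _ erefl; rewrite castmx_id => ->; congr block_mx.
by apply/matrixP=> -[[|[|//]] ?] [[|[|//]] ?]; rewrite !mxE.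
Qed.

(** * Splitting off one block over the reals *)

(* The last clause makes the Omega-orthogonal complement of the rows of [X] also
   M-orthogonal to them. *)
Definition splits_off m (Omega M : 'M[R]_m) :=
  exists p (X : 'M_(p, m)) (B : 'M_p),
    [/\ (0 < p)%N /\ ~~ odd p, williamson_block B,
        X *m Omega *m X^T = stdJ p, X *m M *m X^T = B &
        (X *m M <= X *m Omega)%MS].

Section RealSplitting.
Variables (m : nat) (Omega M : 'M[R]_m).
Hypothesis Omega_skew : Omega^T = - Omega.

Lemma pairing_alt x : pairing Omega x x = 0.
Proof. by have := pairing_skew x x Omega_skew; lra. Qed.

Lemma pairing_pencil (x y : 'rV_m) t :
  x *m M = y *m Omega -> pairing M x t = pairing Omega y t.
Proof. by move=> xM; rewrite /pairing xM. Qed.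

Lemma split_hyperbolic (r : R) (x y : 'rV_m) :
    x *m M = r *: (x *m Omega) -> y *m M = - r *: (y *m Omega) ->
    pairing Omega x y != 0 ->
  splits_off Omega M.
Proof.
move=> xM yM c0; set c := pairing Omega x y in c0.
have fx t : pairing M x t = r * pairing Omega x t by rewrite /pairing xM -scalemxAl mxE.
have fy t : pairing M y t = - r * pairing Omega y t by rewrite /pairing yM -scalemxAl mxE.
have yx : pairing Omega y x = - c by rewrite pairing_skew.
exists 2%N, (frame [:: x; c^-1 *: y]), (hyperbolic_block r 0).
split=> //.
- by constructor; rewrite ?inE ?eqxx ?orbT.
- apply/matrixP=> -[[|[|//]] ?] [[|[|//]] ?];
    by rewrite gramE !rowK mxE /= ?pairingE ?pairing_alt ?yx -/c; field.
- apply/matrixP=> -[[|[|//]] ?] [[|[|//]] ?];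
    by rewrite gramE !rowK mxE /= ?pairingE ?fx ?fy ?pairing_alt ?yx -/c; field.
- set s := [:: _; _]; have sx := nth_frame_sub s Omega 0.
  have sy := nth_frame_sub s Omega 1.
  apply/row_subP => -[[|[|//]] ?]; rewrite row_mul rowK /=.
    by rewrite xM scalemx_sub.
  by rewrite -scalemxAl yM scalerA mulrC -scalerA scalemxAl scalemx_sub.
Qed.

(** The hypotheses say that [x + i y] is an eigenvector of the pencil for [i r]. Both M-squares
    equal [r * pairing Omega x y], so dividing by the square root of the pairing normalises the
    plane. *)
Lemma split_elliptic (r : R) (x y : 'rV_m) :
    x *m M = - r *: (y *m Omega) -> y *m M = r *: (x *m Omega) ->
    pairing Omega x y != 0 ->
  splits_off Omega M.
Proof.
move=> xM yM c0.
(* Exchanging [x] and [y] while negating [r] flips the sign of the pairing. *)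
wlog c_gt0 : r x y xM yM c0 / 0 < pairing Omega x y.
  move=> H; have [c_gt0|] := ltP 0 (pairing Omega x y); first exact: H xM yM c0 c_gt0.
  rewrite le_eqVlt (negPf c0) /= => c_lt0.
  have yx : pairing Omega y x = - pairing Omega x y by rewrite pairing_skew.
  by apply: (H (- r) y x); rewrite ?opprK // yx ?oppr_eq0 ?oppr_gt0.
set c := pairing Omega x y in c0 c_gt0.
have fx t : pairing M x t = - r * pairing Omega y t by rewrite /pairing xM -scalemxAl mxE.
have fy t : pairing M y t = r * pairing Omega x t by rewrite /pairing yM -scalemxAl mxE.
have yx : pairing Omega y x = - c by rewrite pairing_skew.
have d0 : Num.sqrt c != 0 by rewrite sqrtr_eq0 -ltNge.
have dd : c = Num.sqrt c * Num.sqrt c by rewrite -expr2 sqr_sqrtr // ltW.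
set d := Num.sqrt c in d0 dd.
exists 2%N, (frame [:: d^-1 *: x; d^-1 *: y]), (elliptic_block r).
split=> //; first by constructor.
- apply/matrixP=> -[[|[|//]] ?] [[|[|//]] ?];
    by rewrite gramE !rowK mxE /= ?pairingE ?pairing_alt ?yx -/c ?dd; field.
- apply/matrixP=> -[[|[|//]] ?] [[|[|//]] ?];
    by rewrite gramE !rowK mxE /= ?pairingE ?fx ?fy ?pairing_alt ?yx -/c ?dd; field.
- set s := [:: _; _]; have sx := nth_frame_sub s Omega 0.
  have sy := nth_frame_sub s Omega 1.
  apply/row_subP => -[[|[|//]] ?]; rewrite row_mul rowK /= -scalemxAl ?xM ?yM;
    by rewrite scalerA mulrC -scalerA scalemxAl scalemx_sub.
Qed.

(* [a + i b] and [c + i d] are eigenvectors for the eigenvalues [al + i be] and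
   [- al - i be] of the pencil [M - lambda Omega], normalised so that their
   pairing is 2. *)
Lemma split_eigenpair (al be : R) (a b c d : 'rV_m) :
    M^T = M ->
    a *m M = (al *: a - be *: b) *m Omega ->
    b *m M = (be *: a + al *: b) *m Omega ->
    c *m M = (- al *: c + be *: d) *m Omega ->
    d *m M = (- be *: c - al *: d) *m Omega ->
    pairing Omega a c - pairing Omega b d = 2 ->
    pairing Omega a d + pairing Omega b c = 0 ->
  splits_off Omega M.
Proof.
move=> Msym aM bM cM dM Re2 Im0.
(* Real eigenvalue: by [Re2], [a, c] or [b, d] pair nontrivially and span a hyperbolic plane. *)
have [be0|be0] := eqVneq be 0.
  move: aM bM cM dM; rewrite be0 oppr0 !scale0r subr0 addr0 !add0r -!scalemxAl.
  move=> aM bM cM; rewrite -scaleNr -scalemxAl => dM.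
  have [ac0|] := eqVneq (pairing Omega a c) 0; last exact: split_hyperbolic aM cM.
  apply: (split_hyperbolic bM dM); apply/eqP => bd0; move: Re2.
  by rewrite ac0 bd0; lra.
have [al0|al0] := eqVneq al 0.
  move: aM bM cM dM; rewrite al0 oppr0 !scale0r subr0 addr0 !add0r -scaleNr -!scalemxAl.
  move=> aM bM cM dM.
  have [ab0|] := eqVneq (pairing Omega a b) 0; last exact: split_elliptic aM bM.
  have [cd0|] := eqVneq (pairing Omega d c) 0; last exact: split_elliptic dM cM.
  (* Now [w = a + i b] and [w' = c - i d] share the eigenvalue [i be]; by polarisation
     the Hermitian form [Omega x x^*] is nonzero at one of [w], [w'], [w + w'],
     [w + i w'], whose real and imaginary parts span an elliptic plane. *)
  have [e1|] := eqVneq (pairing Omega (a + c) (b - d)) 0; last first.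
    apply: (@split_elliptic be); rewrite !mulmxDl mulNmx ?aM ?bM ?cM ?dM;
      by rewrite ?scalerBr ?scalerDr ?scaleNr ?opprK.
  move: e1 Re2 Im0 ab0 cd0; rewrite !pairingE (pairing_skew c b Omega_skew).
  have [e2|] := eqVneq (pairing Omega (a + d) (b + c)) 0; last first.
    move=> nz _ _ _ _ _; move: nz.
    apply: (@split_elliptic be); rewrite !mulmxDl ?aM ?bM ?cM ?dM;
      by rewrite ?scalerBr ?scalerDr ?scaleNr ?opprK.
  (* This last pairing reduces to [pairing Omega a c - pairing Omega b d], which is 2: a
     contradiction. *)
  move: e2; rewrite !pairingE (pairing_skew d b Omega_skew) (pairing_skew c d Omega_skew).
  lra.
have fa t : pairing M a t = al * pairing Omega a t - be * pairing Omega b t.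
  by rewrite (pairing_pencil _ aM) !pairingE.
have fb t : pairing M b t = be * pairing Omega a t + al * pairing Omega b t.
  by rewrite (pairing_pencil _ bM) !pairingE.
have fc t : pairing M c t = - al * pairing Omega c t + be * pairing Omega d t.
  by rewrite (pairing_pencil _ cM) !pairingE.
have fd t : pairing M d t = - be * pairing Omega c t - al * pairing Omega d t.
  by rewrite (pairing_pencil _ dM) !pairingE.
have ba := pairing_skew b a Omega_skew; have dc := pairing_skew d c Omega_skew.
have ca := pairing_skew c a Omega_skew; have da := pairing_skew d a Omega_skew.
have cb := pairing_skew c b Omega_skew; have db := pairing_skew d b Omega_skew.
have aa := pairing_alt a; have bb := pairing_alt b.
have cc := pairing_alt c; have dd := pairing_alt d.
(* Since [al] and [be] are nonzero, symmetry of [M] kills the pairings of the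
   eigenvectors with their own conjugates and with each other's. *)
have ab : pairing Omega a b = 0.
  apply: (mulfI al0); have := pairing_sym a b Msym; rewrite fa fb aa bb ba; lra.
have cd : pairing Omega c d = 0.
  apply: (mulfI al0); have := pairing_sym c d Msym; rewrite fc fd cc dd dc; lra.
have ac_bd : pairing Omega a c + pairing Omega b d = 0.
  apply: (mulfI be0); have := pairing_sym a d Msym; have := pairing_sym b c Msym.
  rewrite fa fb fc fd ca da cb db; lra.
have ad_bc : pairing Omega a d - pairing Omega b c = 0.
  apply: (mulfI be0); have := pairing_sym a c Msym; have := pairing_sym b d Msym.
  rewrite fa fb fc fd ca da cb db; lra.
have ac : pairing Omega a c = 1 by lra.
have bd : pairing Omega b d = -1 by lra.
have ad : pairing Omega a d = 0 by lra.
have bc : pairing Omega b c = 0 by lra.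
pose valE := (aa, bb, cc, dd, ba, dc, ca, da, cb, db, (ab, cd, ac, bd, ad, bc)).
(* The only nonzero Omega-pairings are those of [a, c] and of [b, - d], both 1, so this order is a
   symplectic basis. The parameters are the M-pairings of [a] with [- d] and with [c]. *)
exists 4%N, (frame [:: a; c; b; - d]), (focus_focus_block (- be) al).
split=> //; first by constructor.
- apply/matrixP=> -[[|[|[|[|//]]]] ?] [[|[|[|[|//]]]] ?];
    rewrite gramE !rowK mxE /= ?pairingE ?valE; ring.
- apply/matrixP=> -[[|[|[|[|//]]]] ?] [[|[|[|[|//]]]] ?];
    rewrite gramE !rowK mxE /= ?pairingE ?fa ?fb ?fc ?fd ?pairingE ?valE; ring.
- set s := [:: _; _; _; _].
  have sa : (a *m Omega <= frame s *m Omega)%MS := nth_frame_sub s Omega 0.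
  have sc : (c *m Omega <= frame s *m Omega)%MS := nth_frame_sub s Omega 1.
  have sb : (b *m Omega <= frame s *m Omega)%MS := nth_frame_sub s Omega 2.
  have := nth_frame_sub s Omega 3; rewrite /= mulNmx eqmx_opp => sd.
  apply/row_subP => -[[|[|[|[|//]]]] ?]; rewrite row_mul rowK /=;
    rewrite ?mulNmx ?eqmx_opp ?aM ?bM ?cM ?dM !mulmxDl ?mulNmx -!scalemxAl;
    by rewrite addmx_sub ?eqmx_opp ?scalemx_sub.
Qed.

End RealSplitting.

(** * Real and imaginary parts *)

Local Notation C := R[i].
Local Notation toC := (real_complex R).

Lemma ReD (x y : C) : complex.Re (x + y) = complex.Re x + complex.Re y.
Proof. by case: x y => [? ?] [? ?]. Qed.

Lemma ImD (x y : C) : complex.Im (x + y) = complex.Im x + complex.Im y.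
Proof. by case: x y => [? ?] [? ?]. Qed.

Section Complexification.
Variables m n : nat.
Implicit Types (x : 'rV[C]_m) (G : 'M[R]_(m, n)).

Lemma RerowM x G :
  map_mx (@complex.Re R) (x *m map_mx toC G) = map_mx (@complex.Re R) x *m G.
Proof.
apply/rowP=> j; rewrite !mxE (big_morph _ ReD (erefl _)).
by apply: eq_bigr => k _; rewrite !mxE; case: (x _ _) => u v /=; rewrite mulr0 subr0.
Qed.

Lemma ImrowM x G :
  map_mx (@complex.Im R) (x *m map_mx toC G) = map_mx (@complex.Im R) x *m G.
Proof.
apply/rowP=> j; rewrite !mxE (big_morph _ ImD (erefl _)).
by apply: eq_bigr => k _; rewrite !mxE; case: (x _ _) => u v /=; rewrite mulr0 add0r.
Qed.

End Complexification.

Section ComplexEigenvectors.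
Variables (m : nat) (G : 'M[R]_m).
Local Notation Re := (@complex.Re R).
Local Notation Im := (@complex.Im R).

(** The form is extended bilinearly, not sesquilinearly, hence the minus sign. *)
Lemma Re_pairing (x y : 'rV[C]_m) :
  Re (pairing (map_mx toC G) x y) =
  pairing G (map_mx Re x) (map_mx Re y) - pairing G (map_mx Im x) (map_mx Im y).
Proof.
rewrite /pairing -RerowM -ImrowM !mxE (big_morph _ ReD (erefl _)) -sumrB.
by apply: eq_bigr => k _; rewrite !mxE; case: (\sum_(_ < _) _) (y _ _) => ? ? [].
Qed.

Lemma Im_pairing (x y : 'rV[C]_m) :
  Im (pairing (map_mx toC G) x y) =
  pairing G (map_mx Re x) (map_mx Im y) + pairing G (map_mx Im x) (map_mx Re y).
Proof.
rewrite /pairing -RerowM -ImrowM !mxE (big_morph _ ImD (erefl _)) -big_split.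
by apply: eq_bigr => k _; rewrite !mxE; case: (\sum_(_ < _) _) (y _ _) => ? ? [].
Qed.

End ComplexEigenvectors.

Lemma map_ReIm_scale m (l : C) (x : 'rV[C]_m) :
  map_mx (@complex.Re R) (l *: x) = complex.Re l *: map_mx (@complex.Re R) x
    - complex.Im l *: map_mx (@complex.Im R) x /\
  map_mx (@complex.Im R) (l *: x) = complex.Im l *: map_mx (@complex.Re R) x
    + complex.Re l *: map_mx (@complex.Im R) x.
Proof.
split; apply/rowP=> k; rewrite !mxE; case: l (x _ _) => ? ? [? ?] //=.
by rewrite addrC.
Qed.

(** * Assembling block-diagonal matrices *)

(* The blocks are indexed by [nat] rather than ['I_k] so that shifting the index
   is a conversion. *)
Definition williamson_sum m (N : 'M[R]_m) :=
  exists (k : nat) (B : nat -> {s : nat & 'M[R]_s})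
         (e : (\sum_(i < k) tag (B i))%N = m),
    (forall i, williamson_block (tagged (B i))) /\
    N = block_diag (fun i : 'I_k => tagged (B i)) e.

Lemma williamson_sum0 (N : 'M[R]_0) : williamson_sum N.
Proof.
(* No block occurs; the elliptic block only fills the values of a total function. *)
exists 0%N, (fun=> Tagged (fun s => 'M[R]_s) (elliptic_block 0)), (big_ord0 _ _ _ _).
by split=> [_|]; [constructor | rewrite [LHS]thinmx0 [RHS]thinmx0].
Qed.

Lemma williamson_sum_cons p q (B : 'M[R]_p) (N : 'M[R]_q) :
  williamson_block B -> williamson_sum N ->
  williamson_sum (block_mx B 0 0 N).
Proof.
move=> wB [k [D [e [wD ->]]]]; case: _ / e.
pose D' i := if i is j.+1 then D j else Tagged (fun s => 'M[R]_s) B.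
exists k.+1, D', (big_ord_recl _ _); split=> [[|i]|//]; first exact: wB.
  exact: wD.
rewrite /block_diag castmx_id mxdiag_recl castmx_comp.
by move: (etrans _ _) => e'; rewrite (eq_irrelevance e' erefl) castmx_id.
Qed.

(** * From complex eigenvectors to a block *)

Lemma eigenvector_ReIm m (Omega M : 'M[R]_m) (l : C) (x : 'rV[C]_m) :
  x *m map_mx toC M = (l *: x) *m map_mx toC Omega ->
  let a := map_mx (@complex.Re R) x in let b := map_mx (@complex.Im R) x in
  a *m M = (complex.Re l *: a - complex.Im l *: b) *m Omega /\
  b *m M = (complex.Im l *: a + complex.Re l *: b) *m Omega.
Proof.
move=> e a b; have [Rel Iml] := map_ReIm_scale l x.
by rewrite -Rel -Iml -!RerowM -!ImrowM e.
Qed.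

Lemma split_complex_eigenpair m (Omega M : 'M[R]_m) (l : C) (w z : 'rV[C]_m) :
    Omega^T = - Omega -> M^T = M ->
    w *m map_mx toC M = (l *: w) *m map_mx toC Omega ->
    z *m map_mx toC M = (- l *: z) *m map_mx toC Omega ->
    pairing (map_mx toC Omega) w z = 2 ->
  splits_off Omega M.
Proof.
move=> skew sym wM zM wz.
case: l => al be in wM zM *; rewrite -[- Complex al be]/(Complex (- al) (- be)) in zM.
have [aM bM] := eigenvector_ReIm wM; have [cM dM] := eigenvector_ReIm zM.
have := congr1 (@complex.Re R) wz; have := congr1 (@complex.Im R) wz.
rewrite Re_pairing Im_pairing => Im0 Re2.
set c := map_mx _ z in cM dM Im0 Re2; set d := map_mx _ z in cM dM Im0 Re2.
apply: (@split_eigenpair _ _ _ skew al be _ _ c d sym aM bM).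
- by rewrite cM /= !scaleNr opprK.
- by rewrite dM /= !scaleNr.
- by rewrite Re2 /=; ring.
- by rewrite Im0 /= addr0.
Qed.

Lemma split_pencil m N (Omega M : 'M[R]_m) (Q : 'M[C]_(N, m)) (D : 'rV[C]_N) :
    (0 < m)%N -> Omega^T = - Omega -> Omega \in unitmx -> M^T = M ->
    row_full Q ->
    Q *m map_mx toC M = diag_mx D *m Q *m map_mx toC Omega ->
  splits_off Omega M.
Proof.
move=> m_gt0 skew unitO sym fullQ pencilQ.
have eigQ i : row i Q *m map_mx toC M = D 0 i *: (row i Q *m map_mx toC Omega).
  rewrite -row_mul pencilQ -mulmxA row_mul row_diag_mx -scalemxAl -rowE.
  by rewrite row_mul.
set OC := map_mx toC Omega; set MC := map_mx toC M.
have skewC : OC^T = - OC by rewrite map_trmx skew map_mxN.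
have symC : MC^T = MC by rewrite map_trmx sym.
(* Otherwise the Gram matrix of the eigenvectors vanishes; cancelling [Q^T] and [OC] then gives
   [Q = 0], against [0 < m]. *)
have [i [j wij]] : exists i j, pairing OC (row i Q) (row j Q) != 0.
  have [/existsP[i /existsP[j ?]]|] :=
      boolP [exists i, exists j, pairing OC (row i Q) (row j Q) != 0].
    by exists i, j.
  rewrite negb_exists => /forallP Q0; have : Q *m OC *m Q^T = 0.
    apply/matrixP => i j; rewrite gramE mxE; move: (Q0 i).
    by rewrite negb_exists => /forallP/(_ j); rewrite negbK => /eqP.
  have fQT : row_free Q^T by rewrite /row_free mxrank_tr.
  have uOC : OC \in unitmx by rewrite map_unitmx.
  move/eqP; rewrite mulmx_free_eq0 // mulmx_free_eq0 ?row_free_unit // => /eqP Q00.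
  by move: fullQ; rewrite /row_full Q00 mxrank0 => /eqP m0; rewrite -m0 in m_gt0.
have pairMQ k t : pairing MC (row k Q) t = D 0 k * pairing OC (row k Q) t.
  by rewrite /pairing eigQ -!scalemxAl mxE.
have lamE : D 0 j = - D 0 i.
  apply: (mulIf wij); have := pairing_sym (row i Q) (row j Q) symC.
  rewrite !pairMQ (pairing_skew (row j Q) _ skewC) => e.
  by rewrite mulNr e mulrN opprK.
(* The pairing is scaled to 2, the normalisation of [split_eigenpair]. *)
pose w := row i Q; pose z := (2 / pairing OC w (row j Q)) *: row j Q.
have wM : w *m MC = (D 0 i *: w) *m OC by rewrite eigQ scalemxAl.
have zM : z *m MC = (- D 0 i *: z) *m OC.
  by rewrite -!scalemxAl eigQ lamE !scalerA mulrC.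
have wz : pairing OC w z = 2 by rewrite !pairingE divfK.
exact: split_complex_eigenpair wM zM wz.
Qed.

(** * Induction on the dimension *)

(* Diagonalisability is kept as a family [Q] of eigenvectors spanning, but not
   necessarily independent: this survives projection to the complement. *)
Lemma williamson_pencil m N (Omega M : 'M[R]_m) (Q : 'M[C]_(N, m)) (D : 'rV[C]_N) :
    Omega^T = - Omega -> Omega \in unitmx -> M^T = M ->
    row_full Q ->
    Q *m map_mx toC M = diag_mx D *m Q *m map_mx toC Omega ->
  exists T : 'M[R]_m,
    T *m Omega *m T^T = stdJ m /\ williamson_sum (T *m M *m T^T).
Proof.
(* [Omega] varies too, since its restriction to a complement need not be in standard form; [N] and
   the eigenvalues [D] stay fixed. *)
elim/ltn_ind: m => m IH in Omega M Q *; move=> skew unitO sym fullQ pencilQ.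
have [m0|m_gt0] := posnP m.
  move: m0 {IH} Omega M Q skew unitO sym fullQ pencilQ => -> *.
  by exists 1%:M; split; [rewrite [LHS]thinmx0 [RHS]thinmx0 | exact: williamson_sum0].
have [p [X [B [[p_gt0 evp] wB XO XM subX]]]] := split_pencil m_gt0 skew unitO sym fullQ pencilQ.
have uJp := stdJ_unit evp.
have fullOX : row_full (Omega *m X^T).
  by apply/row_fullP; exists (invmx (stdJ p) *m X); rewrite -!mulmxA [X *m _]mulmxA XO mulVmx.
have le_pm : (p <= m)%N by rewrite -(eqP fullOX) rank_leq_row.
have [q mpq] : exists q, m = (p + q)%N by exists (m - p)%N; rewrite subnKC.
have [Y freeY] := row_free_kernel fullOX mpq.
rewrite mulmxA => YOX.
have XOY : X *m Omega *m Y^T = 0.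
  by apply: trmx_inj; rewrite tr_gram skew mulmxN mulNmx YOX oppr0 trmx0.
(* Writing [X *m M] as [L *m X *m Omega] reduces this to [XOY]. *)
have XMY : X *m M *m Y^T = 0.
  by case/submxP: subX => L ->; rewrite -!mulmxA [X *m _]mulmxA XOY mulmx0.
have YMX : Y *m M *m X^T = 0.
  by apply: trmx_inj; rewrite tr_gram sym XMY trmx0.
subst m.
(* Pairing a linear relation with [X] kills its [X]-coefficients, as [stdJ p] is invertible; then
   [Y] is free. *)
have uXY : col_mx X Y \in unitmx.
  rewrite -row_free_unit; apply: inj_row_free => v.
  rewrite -[v]hsubmxK mul_row_col => v0.
  have : lsubmx v *m stdJ p = 0.
    move/(congr1 (mulmx^~ (Omega *m X^T))): v0; rewrite mul0mx mulmxDl.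
    by rewrite -!mulmxA ![_ *m (Omega *m _)]mulmxA XO YOX mulmx0 addr0.
  move/(congr1 (mulmx^~ (invmx (stdJ p)))); rewrite mulmxK // mul0mx => vl0.
  move/eqP: v0; rewrite vl0 mul0mx add0r mulmx_free_eq0 // => /eqP->.
  by rewrite row_mx0.
(* [Q2] holds the coordinates of the eigenvectors projected to the complement. *)
have [Q1 [Q2 QE]] : exists Q1 Q2, Q = Q1 *m map_mx toC X + Q2 *m map_mx toC Y.
  pose Q' := Q *m invmx (map_mx toC (col_mx X Y)).
  exists (lsubmx Q'), (rsubmx Q'); rewrite -mul_row_col hsubmxK -map_col_mx mulmxKV //.
  by rewrite map_unitmx.
(* The lower rows of a left inverse of [row_mx Q1 Q2] form a left inverse of [Q2]. *)
have fullQ2 : row_full Q2.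
  have fullQ' : row_full (row_mx Q1 Q2).
    by rewrite /row_full -(@mxrankMfree _ _ _ _ _ (map_mx toC (col_mx X Y))) ?row_free_unit
         ?map_unitmx // map_col_mx mul_row_col -QE.
  case/row_fullP: fullQ' => L; rewrite -[L]vsubmxK mul_mx_row scalar_mx_block.
  rewrite !mul_col_mx => e; apply/row_fullP; exists (dsubmx L).
  by move/(congr1 (dsubmx \o rsubmx)): e; rewrite /= block_mxEh !row_mxKr !col_mxKd.
have pencilQ2 : Q2 *m map_mx toC (Y *m M *m Y^T) =
    diag_mx D *m Q2 *m map_mx toC (Y *m Omega *m Y^T).
  have := congr1 (mulmx^~ (map_mx toC Y^T)) pencilQ.
  rewrite QE !mulmxDr !mulmxDl -!mulmxA -!map_mxM !mulmxA XMY XOY !map_mx0 !mulmx0.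
  by rewrite !add0r.
have gramO := mul_block_gram X Y Omega; rewrite XO XOY YOX in gramO.
(* The Gram matrix of the whole basis is invertible and block-diagonal. *)
have uO' : Y *m Omega *m Y^T \in unitmx.
  have : col_mx X Y *m Omega *m (col_mx X Y)^T \in unitmx.
    by rewrite !unitmx_mul unitmx_tr uXY unitO.
  by rewrite gramO !unitmxE det_ublock unitrM => /andP[].
have skew' : (Y *m Omega *m Y^T)^T = - (Y *m Omega *m Y^T).
  by rewrite tr_gram skew mulmxN mulNmx.
have sym' : (Y *m M *m Y^T)^T = Y *m M *m Y^T by rewrite tr_gram sym.
have q_lt : (q < p + q)%N by rewrite -addn1 addnC leq_add2r.
have [T [TO TM]] := IH q q_lt _ _ _ skew' uO' sym' fullQ2 pencilQ2.
exists (col_mx X (T *m Y)).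
rewrite !mul_block_gram !trmx_mul XO XM !mulmxA XOY XMY !mul0mx.
rewrite -!(mulmxA T) YOX YMX !mulmx0 !mulmxA.
rewrite !mulmxA in TO TM; rewrite TO stdJ_block //; split=> //.
exact: williamson_sum_cons.
Qed.

End Williamson.

Theorem theorem6p2 (R : realType) (n : nat) (hn : (0 < n)%N)
  (M : 'M[R]_(2 * n)) (hsym : M^T = M) (hinv : M \in unitmx)
  (hdiag : diagonalizable_over_C (invmx (Omega0 R n) *m M)) :
  exists S : 'M[R]_(2 * n), symplectic S /\
    exists (k : nat) (p : 'I_k -> nat) (B : forall i : 'I_k, 'M[R]_(p i))
           (e : (\sum_(i < k) p i)%N = (2 * n)%N),
      (forall i : 'I_k, williamson_block (B i)) /\
      S^T *m M *m S = block_diag B e.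
Proof.
have uO : Omega0 R n \in unitmx by rewrite Omega0E stdJ_unit // mul2n odd_double.
have skewO : (Omega0 R n)^T = - Omega0 R n by rewrite Omega0E stdJ_skew.
case: hdiag => P uP /diagonalizable_forPex[D /(simmxP uP) PD].
(* The columns of the inverse of [P] are eigenvectors of [invmx (Omega0 R n) *m M]; transposition
   makes them rows. *)
pose Q := (invmx P)^T.
have fullQ : row_full Q by rewrite row_full_unit unitmx_tr unitmx_inv.
(* Transposing turns [Omega0] into its opposite, hence the sign of [D]. *)
have pencilQ : Q *m map_mx (real_complex R) M =
    diag_mx (- D) *m Q *m map_mx (real_complex R) (Omega0 R n).
  set OC := map_mx _ (Omega0 R n); set MC := map_mx _ M.
  have {}PD : MC *m invmx P = OC *m invmx P *m diag_mx D.
    have -> : MC = OC *m map_mx (real_complex R) (invmx (Omega0 R n) *m M).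
      by rewrite -map_mxM mulKVmx.
    rewrite -!mulmxA; congr (_ *m _); apply: (can_inj (mulKmx uP)).
    by rewrite mulmxA PD mulmxK // mulKVmx.
  have := congr1 trmx PD; rewrite !trmx_mul tr_diag_mx !map_trmx hsym skewO.
  by rewrite -/MC -/Q map_mxN !mulmxN mulmxA => ->; rewrite raddfN !mulNmx.
have [T [TO [k [B [e [wB TM]]]]]] := williamson_pencil skewO uO hsym fullQ pencilQ.
(* [T] lists the symplectic basis in rows, [S] in columns. *)
exists T^T; rewrite /symplectic trmxK; split; first by rewrite TO Omega0E.
by exists k, (fun i => tag (B i)), (fun i => tagged (B i)), e.
Qed.
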